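(* Let $X$ be an infinite compact metrizable monothetic group and $Tx=ax$ a minimal rotation of $X$ (i.e. $a\in X$ and $\{a^n:n\in\mathbb Z\}$ is dense in $X$). Let $G$ be a countable discrete group and $f:X\to G$ a continuous recurrent cocycle over $(X,T)$. Then $f$ is regular. Moreover, $f$ is continuously cohomologous to a cocycle $\widehat f$ taking values in a finite subgroup $K\subset G$, and $\widehat f$ is ergodic (as a $K$-valued cocycle).
   Context: A continuous map $f:X\to G$ defines a $\mathbb Z$-cocycle by $f(n,x)=f(T^{n-1}x)\cdots f(Tx)f(x)$ for $n\ge 1$, $f(0,x)=e$, and $f(n,x)=f(-n,T^nx)^{-1}$ for $n<0$. The skew product is the $\mathbb Z$-action on $X\times G$ given by $T_f^n(x,g)=(T^nx,f(n,x)g)$. The cocycle $f$ is recurrent if for every nonempty open $O\subset X\times G$ there is an integer $n\ne0$ with $T_f^nO\cap O\neq\varnothing$. It is regular if there exists $(x_0,g_0)\in X\times G$ such that the projection to $X$ of the orbit closure $\overline{T_f^{\mathbb Z}(x_0,g_0)}$ is all of $X$. Cocycles $f,\widehat f:X\to G$ are continuously cohomologous if there is a continuous $b:X\to G$ with $\widehat f(x)=b(Tx)^{-1}f(x)b(x)$ for all $x\in X$. A continuous cocycle $\widehat f$ with values in a closed subgroup $K$ is ergodic (in $K$) if the skew product $T_{\widehat f}$ on $X\times K$ is topologically ergodic: for all nonempty open $O_1,O_2\subset X\times K$ there is $n\in\mathbb Z$ with $T_{\widehat f}^nO_1\cap O_2\ne\varnothing$. *)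

(* Defs.v *)
From HB Require Import structures.
From mathcomp Require Import all_boot all_order all_algebra.
From mathcomp Require Import all_classical all_reals all_analysis.

Set Implicit Arguments.
Unset Strict Implicit.
Unset Printing Implicit Defensive.

Import Order.TTheory GRing.Theory Num.Theory.

Local Open Scope classical_set_scope.
Local Open Scope group_scope.

(* MathComp-Analysis only provides additive (commutative) topological groups. *)
HB.mixin Record Group_isTopologicalGroup T of Topological T & Group T := {
  mulg_continuous : continuous (fun p : T * T => p.1 * p.2) ;
  invg_continuous : continuous (fun x : T => x^-1)
}.

#[short(type="topologicalGroupType")]
HB.structure Definition TopologicalGroup :=
  { T of Topological T & Group T & Group_isTopologicalGroup T }.

#[short(type="discreteGroupType")]
HB.structure Definition DiscreteGroup :=
  { T of DiscreteTopology T & TopologicalGroup T }.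

Definition metrizable (R : realType) (T : topologicalType) : Prop :=
  exists d : T -> T -> R,
    [/\ forall x, d x x = 0%R,
        forall x y, d x y = 0%R -> x = y,
        forall x y, d x y = d y x,
        forall x y z, (d x z <= d x y + d y z)%R &
        forall (x : T) (A : set T),
          nbhs x A <-> exists2 e : R, (0 < e)%R & [set y | d x y < e]%R `<=` A].

Definition expgz (G : groupType) (a : G) (n : int) : G :=
  match n with
  | Posz k => a ^+ k
  | Negz k => a ^- k.+1
  end.

Definition monothetic (X : topologicalGroupType) : Prop :=
  exists a : X, dense (range (expgz a)).

(* The Z-action n |-> T^n generated by T x = a x; thus T itself is
   [rotation a 1]. *)
Definition rotation (X : groupType) (a : X) (n : int) (x : X) : X :=
  expgz a n * x.

Definition minimal_rotation (X : topologicalGroupType) (a : X) : Prop :=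
  dense (range (expgz a)).

(* Below, a Z-action on X is represented by the family [T n] of its maps. *)

Fixpoint cocycle_nat (X : Type) (G : groupType) (T : int -> X -> X)
    (f : X -> G) (n : nat) (x : X) : G :=
  match n with
  | 0%N => 1
  | m.+1 => f (T (Posz m) x) * cocycle_nat T f m x
  end.

(* [Negz k] is the integer -(k+1). *)
Definition cocycle (X : Type) (G : groupType) (T : int -> X -> X)
    (f : X -> G) (n : int) (x : X) : G :=
  match n with
  | Posz k => cocycle_nat T f k x
  | Negz k => (cocycle_nat T f k.+1 (T n x))^-1
  end.

Definition skew_product (X : Type) (G : groupType) (T : int -> X -> X)
    (f : X -> G) (n : int) (p : X * G) : X * G :=
  (T n p.1, cocycle T f n p.1 * p.2).

Definition recurrent (X : topologicalType) (G : topologicalGroupType)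
    (T : int -> X -> X) (f : X -> G) : Prop :=
  forall O : set (X * G), open O -> O !=set0 ->
    exists2 n : int, n <> 0%R & skew_product T f n @` O `&` O !=set0.

Definition regular (X : topologicalType) (G : topologicalGroupType)
    (T : int -> X -> X) (f : X -> G) : Prop :=
  exists p : X * G, fst @` closure (range (fun n => skew_product T f n p)) = [set: X].

Definition cohomologous (X : topologicalType) (G : topologicalGroupType)
    (T : int -> X -> X) (f fh : X -> G) : Prop :=
  exists2 b : X -> G, continuous b &
    forall x, fh x = (b (T 1%R x))^-1 * f x * b x.

(* For K-valued f. The open subsets of X * K are the open sets of
   [subspace (X * K)] that are included in X * K: in [subspace A] every subset
   of the complement of A is open, hence the inclusion hypotheses. *)
Definition ergodic_in (X : topologicalType) (G : topologicalGroupType)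
    (T : int -> X -> X) (f : X -> G) (K : set G) : Prop :=
  let XK := [set: X] `*` K in
  forall O1 O2 : set (X * G),
    O1 `<=` XK -> open (O1 : set (subspace XK)) -> O1 !=set0 ->
    O2 `<=` XK -> open (O2 : set (subspace XK)) -> O2 !=set0 ->
    exists n : int, skew_product T f n @` O1 `&` O2 !=set0.

(* Main.v *)
(* Right translations preserving the locally constant [f] form an open subgroup
   [V], by compactness. Recurrence provides [n <> 0] with [a^n] in [V] and
   [f(n, 1) = 1], so that [m |-> f(m, 1)] is [n]-periodic, hence takes finitely
   many values. Let [E x] be the fiber over [x] of the closure of the orbit of
   [(1, 1)]. By finiteness and density every [E x] is nonempty (regularity) and
   [E] is locally constant; moreover [K := E 1] is a finite subgroup, every [E x]
   is a left coset of [K], and [E (a x) = f x E x]. Any choice of [b x] in [E x]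
   depending only on [E x] is thus a continuous transfer function to a K-valued
   cocycle; this cocycle is ergodic because a single orbit, that of [(1, 1)],
   accumulates at every [(x, g)] with [g] in [E x]. *)
From HB Require Import structures.
Require Import Defs.
From mathcomp Require Import all_boot all_order all_algebra.
From mathcomp Require Import all_classical all_reals all_analysis.
Import GRing.Theory.

Set Implicit Arguments.
Unset Strict Implicit.
Unset Printing Implicit Defensive.

Local Open Scope classical_set_scope.
Local Open Scope group_scope.

(** * Integer powers and recursion over the integers *)

Lemma oppzS_add1 (n : nat) : (- n.+1%:Z + 1 = - n%:Z)%R.
Proof. by rewrite -addn1 PoszD opprD addrNK. Qed.

(** Cancelling [F n] runs the recursion backwards as well. The identities over [int] below follow
    without splitting on signs. *)
Lemma int_rec_unique (G : groupType) (F u v : int -> G) :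
  (forall n, u (n + 1)%R = F n * u n) -> (forall n, v (n + 1)%R = F n * v n) ->
  u 0%R = v 0%R -> u =1 v.
Proof.
move=> uS vS uv0; elim/int_rect => [//|n IHn|n IHn].
  by rewrite -addn1 PoszD uS vS IHn.
have := uS (- n.+1%:Z)%R.
by rewrite oppzS_add1 IHn -oppzS_add1 vS => /mulgI.
Qed.

Lemma expgzS (G : groupType) (a : G) (n : int) :
  expgz a (n + 1)%R = a * expgz a n.
Proof.
case: n => [n|[|n]].
- by rewrite -PoszD addn1 /= expgS.
- by rewrite /= expg1 mulgV.
- have -> : (Negz n.+1 + 1 = Negz n)%R by rewrite !NegzE oppzS_add1.
  by rewrite /= [a ^+ n.+2]expgSr invgM mulVKg.
Qed.

Lemma expgzD (G : groupType) (a : G) (n m : int) :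
  expgz a (n + m)%R = expgz a n * expgz a m.
Proof.
apply: (@int_rec_unique _ (fun=> a) (fun n => expgz a (n + m)%R)
  (fun n => expgz a n * expgz a m)) => [k|k|].
- by rewrite addrAC expgzS.
- by rewrite expgzS mulgA.
- by rewrite add0r /= mul1g.
Qed.

Lemma expgzN (G : groupType) (a : G) (n : int) :
  expgz a (- n)%R = (expgz a n)^-1.
Proof. by apply: (mulIg (expgz a n)); rewrite -expgzD addNr mulVg. Qed.

Lemma rotationD (X : groupType) (a : X) (n m : int) (x : X) :
  rotation a (n + m)%R x = rotation a n (rotation a m x).
Proof. by rewrite /rotation expgzD mulgA. Qed.

(** * Cocycle identities and right periods *)

Section Cocycle.
Context (X G : groupType) (a : X) (f : X -> G).

Lemma cocycle_natSr (n : nat) (x : X) :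
  cocycle_nat (rotation a) f n.+1 x =
  cocycle_nat (rotation a) f n (rotation a 1%R x) * f x.
Proof.
elim: n => [|n IHn]; first by rewrite /= /rotation /= !mul1g mulg1.
rewrite [LHS]/= -/(cocycle_nat (rotation a) f n.+1 x) IHn mulgA /=.
by rewrite -rotationD -PoszD addn1.
Qed.

Lemma cocycleS (n : int) (x : X) :
  cocycle (rotation a) f (n + 1)%R x =
  f (rotation a n x) * cocycle (rotation a) f n x.
Proof.
case: n => [n|n]; first by rewrite -PoszD addn1.
(* For a negative time, peel off the earliest factor, which is the value of [f] at the starting
   point [rotation a (Negz n) x]. *)
rewrite /cocycle cocycle_natSr invgM mulVKg -rotationD [(1 + _)%R]addrC.
case: n => [|n]; first by rewrite /= invg1.
by have -> : (Negz n.+1 + 1 = Negz n)%R by rewrite !NegzE oppzS_add1.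
Qed.

Lemma cocycleD (n m : int) (x : X) :
  cocycle (rotation a) f (n + m)%R x =
  cocycle (rotation a) f n (rotation a m x) * cocycle (rotation a) f m x.
Proof.
apply: (@int_rec_unique _ (fun n => f (rotation a (n + m)%R x))
  (fun n => cocycle (rotation a) f (n + m)%R x)
  (fun n => cocycle (rotation a) f n (rotation a m x) *
            cocycle (rotation a) f m x)) => [k|k|].
- by rewrite addrAC cocycleS.
- by rewrite cocycleS mulgA rotationD.
- by rewrite add0r mul1g.
Qed.

Definition right_period (v : X) : Prop := forall x, f (x * v) = f x.

Lemma right_periodM (u v : X) :
  right_period u -> right_period v -> right_period (u * v).
Proof. by move=> uP vP x; rewrite mulgA vP uP. Qed.

Lemma right_periodV (u : X) : right_period u -> right_period u^-1.
Proof. by move=> uP x; rewrite -[LHS]uP -mulgA mulVg mulg1. Qed.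

(** Right translations commute with [rotation a], a left multiplication, so every factor of the
    product is unchanged. *)
Lemma cocycle_right_period (v : X) (n : int) (x : X) : right_period v ->
  cocycle (rotation a) f n (x * v) = cocycle (rotation a) f n x.
Proof.
move=> vP; apply: (@int_rec_unique _ (fun n => f (rotation a n x))
  (fun n => cocycle (rotation a) f n (x * v))
  (fun n => cocycle (rotation a) f n x)) => [k|k|//].
- by rewrite cocycleS /rotation mulgA vP.
- by rewrite cocycleS.
Qed.

Definition cocycle1 (n : int) : G := cocycle (rotation a) f n 1.

Lemma cocycle1_add (n m : int) : right_period (expgz a m) ->
  cocycle1 (n + m)%R = cocycle1 n * cocycle1 m.
Proof.
move=> mP; rewrite /cocycle1 cocycleD [rotation a m 1]mulg1.
by rewrite -[expgz a m]mul1g cocycle_right_period.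
Qed.

(** Adding [n] to the time leaves [cocycle1] unchanged, so times may be reduced modulo [n]. *)
Lemma cocycle1_finite_range (n : int) : n != 0%R ->
  right_period (expgz a n) -> cocycle1 n = 1 ->
  exists N : nat, forall m, exists r : 'I_N, cocycle1 m = cocycle1 r%:Z.
Proof.
move=> n0 nP n1; exists `|n|%N => m.
have addn k : cocycle1 (k + n)%R = cocycle1 k by rewrite cocycle1_add // n1 mulg1.
have mod_lt : (`|(m %% n)%Z|%N < `|n|%N)%N.
  by rewrite -ltz_nat gez0_abs ?modz_ge0 // ltz_mod.
exists (Ordinal mod_lt); transitivity (cocycle1 (m %% n)%Z); last first.
  by congr cocycle1; apply/esym/gez0_abs/modz_ge0.
rewrite {1}(divz_eq m n).
apply: (@int_rec_unique _ (fun=> 1) (fun k => cocycle1 (k * n + (m %% n)%Z)%R)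
  (fun=> cocycle1 (m %% n)%Z)) => [k|k|].
- by rewrite mulrDl mul1r addrAC addn mul1g.
- by rewrite mul1g.
- by rewrite mul0r add0r.
Qed.

End Cocycle.

Lemma cocycle_cohomologous (X G : groupType) (a : X) (f b fh : X -> G) :
  (forall x, fh x = (b (rotation a 1%R x))^-1 * f x * b x) ->
  forall n x, cocycle (rotation a) fh n x =
    (b (rotation a n x))^-1 * cocycle (rotation a) f n x * b x.
Proof.
move=> fhE n x.
apply: (@int_rec_unique _ (fun n => fh (rotation a n x))
  (fun n => cocycle (rotation a) fh n x)
  (fun n => (b (rotation a n x))^-1 * cocycle (rotation a) f n x * b x)).
- by move=> k; rewrite cocycleS.
- move=> k; rewrite cocycleS fhE -rotationD [(1 + k)%R]addrC.
  by rewrite !mulgA mulgK.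
- by rewrite /= {1}/rotation /= mul1g mulg1 mulVg.
Qed.

(** * Local constancy and small translations *)

Lemma continuous_discreteP (X : topologicalType) (G : discreteGroupType)
    (f : X -> G) :
  continuous f <-> forall x, \forall y \near x, f y = f x.
Proof.
split=> [cf x|fP x A /nbhs_singleton Ax].
  exact: (cf x _ (discrete_set1 (f x))).
by apply: filterS (fP x) => y /= ->.
Qed.

Lemma nbhs_right_period (X : topologicalGroupType) (G : discreteGroupType)
    (f : X -> G) : compact [set: X] -> continuous f ->
  nbhs (1 : X) [set v | right_period f v].
Proof.
move=> /compact_near_coveringP cX /continuous_discreteP cf.
suff : \forall v \near (1 : X), [set: X] `<=` (fun x => f (x * v) = f x).
  by apply: filterS => v vP x; exact: vP.
apply: (cX X (nbhs (1 : X)) (fun v x => f (x * v) = f x)) => x _.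
have /(_ [set y | f y = f x]) := @mulg_continuous X (x, 1).
rewrite /= mulg1 => /(_ (cf x)) [[A B] [/= xA B1] AB].
exists (A, B) => //= -[y v] [/= Ay Bv].
(* Both [f (y * v)] and, taking [v = 1], [f y] equal [f x]. *)
rewrite (AB (y, v)) //=.
by have := AB (y, 1) (conj Ay (nbhs_singleton B1)); rewrite /= mulg1.
Qed.

Lemma rotation_continuous (X : topologicalGroupType) (a : X) (n : int) :
  continuous (rotation a n).
Proof.
move=> x W /(@mulg_continuous X (expgz a n, x) W) [[A B] [/= Aa xB] AB].
apply: filterS xB => y By.
exact: (AB (expgz a n, y) (conj (nbhs_singleton Aa) By)).
Qed.

Lemma nbhs_mulVg (X : topologicalGroupType) (x : X) (W : set X) : nbhs 1 W ->
  exists2 A, nbhs x A & forall y z, A y -> A z -> W (y^-1 * z).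
Proof.
rewrite -(mulVg x) => Wx.
have [[A B] [/= xA xB] AB] := @mulg_continuous X (x^-1, x) W Wx.
exists ([set y | A y^-1] `&` B).
  by apply: filterI => //; exact: (@invg_continuous X x).
by move=> y z [Ay _] [_ Bz]; exact: (AB (y^-1, z)).
Qed.

(** * Fibers of the orbit closure *)

Section OrbitClosure.
Context (X : topologicalGroupType) (G : discreteGroupType) (a : X) (f : X -> G).

(* The fiber over [x] of the closure of the orbit of (1, 1). *)
Definition fiber (x : X) : set G :=
  [set g | forall W, nbhs x W ->
    exists2 n, W (expgz a n) & cocycle1 a f n = g].

Lemma fiber_closure (x : X) (g : G) : fiber x g ->
  closure (range (fun n => skew_product (rotation a) f n (1, 1))) (x, g).
Proof.
move=> Exg B [[W U] [/= xW gU] WUB].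
have [n Wn ng] := Exg _ xW.
exists (skew_product (rotation a) f n (1, 1)); split; first by exists n.
apply: WUB; split=> /=; first by rewrite /rotation mulg1.
by rewrite mulg1 -/(cocycle1 a f n) ng; exact: nbhs_singleton.
Qed.

Lemma fiber1 : fiber 1 1.
Proof. by move=> W /nbhs_singleton W1; exists 0%R. Qed.

Context (near_period : nbhs (1 : X) [set v | right_period f v]).

(** If times [n] and [m] both bring the orbit close to [x], then [expgz a (m - n)] is close to 1 and
    a right period, so [cocycle1] splits along [n + (m - n)]. *)
Lemma fiber_mulVg (x : X) (g h : G) : fiber x g -> fiber x h ->
  fiber 1 (g^-1 * h).
Proof.
move=> xg xh W W1.
have [A xA AW] := nbhs_mulVg x (filterI W1 near_period).
have [n An <-] := xg _ xA; have [m Am <-] := xh _ xA.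
have [] := AW _ _ An Am.
rewrite -expgzN -expgzD => Wnm Pnm.
exists (- n + m)%R => //.
apply: (mulgI (cocycle1 a f n)); rewrite mulVKg -cocycle1_add //.
by rewrite addrA subrr add0r.
Qed.

Lemma fiber_mulg (x : X) (g k : G) : fiber x g -> fiber 1 k -> fiber x (g * k).
Proof.
move=> xg k1 W Wx.
have := @mulg_continuous X (x, 1) W; rewrite /= mulg1 => /(_ Wx).
move=> [[A B] [/= xA B1] AB].
have [n An <-] := xg _ xA; have [m [Bm Pm] <-] := k1 _ (filterI B1 near_period).
exists (n + m)%R; last by rewrite cocycle1_add.
by rewrite expgzD; exact: (AB (expgz a n, expgz a m)).
Qed.

Lemma fiber_rotation (x : X) (g : G) :
  fiber x g -> fiber (rotation a 1%R x) (f x * g).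
Proof.
move=> xg W Wx.
have Wa : nbhs x [set y | W (rotation a 1%R y)].
  exact: (@rotation_continuous X a 1%R x W Wx).
have [C xC CP] := nbhs_mulVg x near_period.
have [n [/= Wn Cn] <-] := xg _ (filterI Wa xC).
exists (n + 1)%R; first by rewrite addrC expgzD.
rewrite /cocycle1 cocycleS [rotation a n 1]mulg1.
(* [expgz a n] is [x] times a right period, so [f] agrees at both points. *)
by congr (_ * _); rewrite -(CP _ _ (nbhs_singleton xC) Cn x) mulVKg.
Qed.

Lemma fiberE (x : X) (g : G) : fiber x g -> fiber x = [set g * k | k in fiber 1].
Proof.
move=> xg; apply/seteqP; split=> [h xh|_ [k k1 <-]]; last exact: fiber_mulg.
by exists (g^-1 * h); [exact: fiber_mulVg xh|rewrite mulVKg].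
Qed.

Lemma fiber_group_closed : group_closed (fun g : G => `[<fiber 1 g>]).
Proof.
have inv k : fiber 1 k -> fiber 1 k^-1.
  by move=> k1; rewrite -[k^-1]mulg1; exact: fiber_mulVg fiber1.
split=> [|g h]; first exact/asboolP/fiber1.
move=> /asboolP g1 /asboolP h1; apply/asboolP.
by apply: fiber_mulg => //; exact: inv.
Qed.

Context (N : nat) (dense_a : dense (range (expgz a))).
Context (finite_range :
  forall m, exists r : 'I_N, cocycle1 a f m = cocycle1 a f r%:Z).

Lemma fiber_finite (x : X) : finite_set (fiber x).
Proof.
apply: (@sub_finite_set _ _ [set cocycle1 a f r%:Z | r in [set: 'I_N]]).
  move=> g /(_ _ filterT) [n _ <-].
  by have [r ->] := finite_range n; exists r.
exact/finite_image/finite_finset.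
Qed.

Lemma fiber_neq0 (x : X) : fiber x !=set0.
Proof.
apply: contrapT => Ex0.
(* [P] holds the points not visited by the orbit with any of the [N] listed values. Being a finite
   intersection of neighbourhoods of [x], it must meet the dense orbit. *)
pose P := [set y | forall (r : 'I_N) n,
  y = expgz a n -> cocycle1 a f n <> cocycle1 a f r%:Z].
have xP : nbhs x P.
  apply: filter_forall => r; apply: contrapT => xr; apply: Ex0.
  exists (cocycle1 a f r%:Z) => W Wx; apply: contrapT => Wn; apply: xr.
  by apply: filterS Wx => y Wy n yE rE; apply: Wn; exists n; rewrite // -yE.
have [y [/interior_subset Py [n _ nE]]] :=
  @dense_a P^° (ex_intro _ x xP) (open_interior P).
have [r nr] := finite_range n.
exact: (Py r n (esym nE) nr).
Qed.

Lemma near_fiber (x : X) : \forall y \near x, fiber y = fiber x.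
Proof.
(* One inclusion suffices: the two fibers then share an element, and each is the coset of [fiber 1]
   through it. *)
suff : \forall y \near x, forall r : 'I_N,
    fiber y (cocycle1 a f r%:Z) -> fiber x (cocycle1 a f r%:Z).
  apply: filterS => y yx; have [g yg] := fiber_neq0 y.
  have xg : fiber x g.
    have [n _ gE] := yg _ filterT; have [r nr] := finite_range n.
    by move: yg; rewrite -gE nr; exact: yx.
  by rewrite (fiberE yg) (fiberE xg).
apply: filter_forall => r.
have [xr|] := pselect (fiber x (cocycle1 a f r%:Z)).
  exact: nearW.
(* A neighbourhood [W] witnessing that the value is not in the fiber over [x] serves every point of
   its interior. *)
move=> /existsNP [W /not_implyP [/nbhs_interior Wx NW]].
apply: filterS Wx => y Wy yr; exfalso; apply: NW; exact: yr.
Qed.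

End OrbitClosure.

(** * Recurrence, and assembly of the theorem *)

Lemma subspace_open_nbhs (X : topologicalType) (G : discreteGroupType)
    (K : set G) (O : set (X * G)) (x : X) (k : G) :
  open (O : set (subspace ([set: X] `*` K))) -> O (x, k) -> K k ->
  \forall y \near x, O (y, k).
Proof.
move=> /open_subspaceP [U Uo UO] Oxk Kk.
have Uxk : U (x, k) by have [] : (U `&` ([set: X] `*` K)) (x, k) by rewrite UO.
have [[A B] [/= xA kB] AB] := open_nbhs_nbhs (conj Uo Uxk).
apply: filterS xA => y Ay.
have : (U `&` ([set: X] `*` K)) (y, k).
  by split=> //; apply: AB; split=> //; exact: nbhs_singleton.
by rewrite UO => -[].
Qed.

Lemma recurrent_right_period (X : topologicalGroupType) (G : discreteGroupType)
    (a : X) (f : X -> G) :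
  nbhs (1 : X) [set v | right_period f v] -> recurrent (rotation a) f ->
  exists n : int, [/\ n != 0%R, right_period f (expgz a n) &
    cocycle1 a f n = 1].
Proof.
move=> V1 rec_f.
have [||n n0 [_ [[[x g] /interior_subset [/= xV ->] <-] /interior_subset]]] :=
    rec_f ([set v | right_period f v] `*` [set 1])^°.
- exact: open_interior.
- by exists (1, 1), ([set v | right_period f v], [set 1]) => //; split=> //;
     exact: discrete_set1.
move=> [/= anxV]; rewrite mulg1 => fnx.
exists n; split; first exact/eqP.
  (* Both [x] and [expgz a n * x] are right periods, hence so is their quotient. *)
  rewrite -[expgz a n](mulgK x).
  exact: right_periodM anxV (right_periodV xV).
by rewrite /cocycle1 -(cocycle_right_period a n 1 xV) mul1g.
Qed.

Theorem theorem3p1 (R : realType) (X : topologicalGroupType) (a : X)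
    (X_infinite : infinite_set [set: X])
    (X_compact : compact [set: X])
    (X_metrizable : metrizable R X)
    (X_monothetic : monothetic X)
    (a_minimal : minimal_rotation a)
    (G : discreteGroupType)
    (G_countable : countable [set: G])
    (f : X -> G)
    (f_continuous : continuous f)
    (f_recurrent : recurrent (rotation a) f) :
  regular (rotation a) f /\
  exists (K : groupClosed G) (fh : X -> G),
    [/\ finite_set [set` K],
        continuous fh,
        forall x, fh x \in K,
        cohomologous (rotation a) f fh &
        ergodic_in (rotation a) fh [set` K]].
Proof.
have V1 := nbhs_right_period X_compact f_continuous.
have [p [p0 pV fp]] := recurrent_right_period V1 f_recurrent.
have [N finN] := cocycle1_finite_range p0 pV fp.
pose E := fiber a f.
have E0 x : E x !=set0 by exact: fiber_neq0 a_minimal finN x.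
split.
  exists (1, 1); apply/seteqP; split=> // x _.
  by have [g xg] := E0 x; exists (x, g) => //; exact: fiber_closure.
have cS := fiber_group_closed a V1.
pose S : {pred G} := fun g => `[<E 1 g>].
pose K : groupClosed G := HB.pack S (isInvClosed.Build G S (group_closedV cS))
  (isMul1Closed.Build G S (fst cS)) (isMulClosed.Build G S (group_closedM cS)).
have KE g : (g \in K) = `[<E 1 g>] by [].
(* The choice depends only on the set [E x], so [b] is locally constant like [E]. The default 1
   never occurs, as fibers are nonempty. *)
pose b x : G := xget 1 (E x).
have bE x : E x (b x) by have [g] := E0 x; exact: xgetI.
have near_b x : \forall y \near x, b y = b x.
  by apply: filterS (near_fiber V1 a_minimal finN x) => y;
     rewrite /b /E => ->.
pose fh x := (b (rotation a 1%R x))^-1 * f x * b x.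
exists K, fh; split.
- apply: sub_finite_set (fiber_finite finN 1) => g.
  by rewrite /= KE => /asboolP.
- apply/continuous_discreteP => x.
  have near_f := (continuous_discreteP f).1 f_continuous x.
  have near_bT : \forall y \near x, b (rotation a 1%R y) = b (rotation a 1%R x).
    exact: (@rotation_continuous X a 1%R x _ (near_b _)).
  by apply: filterS3 near_f (near_b x) near_bT => y fy b_y bTy;
     rewrite /fh fy b_y bTy.
- move=> x; rewrite KE; apply/asboolP; rewrite /fh -mulgA.
  exact: (fiber_mulVg V1 (bE _) (fiber_rotation V1 (bE x))).
- by exists b => //; apply/continuous_discreteP.
rewrite /ergodic_in => O1 O2 O1K O1o O1nz O2K O2o O2nz.
have [[x1 k1] O1x] := O1nz; have [[x2 k2] O2x] := O2nz.
pose XK := [set: X] `*` [set` K].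
(* The orbit of [(1, 1)] comes near [(x, b x * k)]; dividing by [b] turns this into a visit to [O]
   at height [k]. *)
have near_O O x k : O `<=` XK -> open (O : set (subspace XK)) -> O (x, k) ->
    exists n, [/\ O (expgz a n, k), b (expgz a n) = b x &
      cocycle1 a f n = b x * k].
  move=> OK Oo Ox; have [_ /= Kk] := OK _ Ox.
  have xk : E x (b x * k).
    by apply: (fiber_mulg V1 (bE x)); apply/asboolP; rewrite -KE.
  have [n [On bn] fn] :=
    xk _ (filterI (subspace_open_nbhs Oo Ox Kk) (near_b x)).
  by exists n.
have [n [nO1 bn fn]] := near_O _ _ _ O1K O1o O1x.
have [m [mO2 bm fm]] := near_O _ _ _ O2K O2o O2x.
(* Time [m - n] carries the visit to [O1] at time [n] to the visit to [O2] at time [m]. *)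
exists (m - n)%R, (expgz a m, k2); split=> //.
exists (expgz a n, k1) => //; rewrite /skew_product /=.
have amn : rotation a (m - n)%R (expgz a n) = expgz a m.
  by rewrite /rotation -expgzD subrK.
rewrite (@cocycle_cohomologous _ _ a f b fh) // amn bm bn; congr pair.
have := cocycleD a f (m - n)%R n 1; rewrite subrK [rotation a n 1]mulg1.
rewrite -!/(cocycle1 a f _) fm fn => fmn; apply: (mulgI (b x2)).
by rewrite fmn !mulgA mulgV mul1g.
Qed.
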